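(* Let $(\mathfrak{g},\omega)$ be a symplectic Novikov Lie algebra (SNLA). Then every symplectic reduction $(\overline{\mathfrak{g}},\overline{\omega})$ of $(\mathfrak{g},\omega)$ (with respect to an isotropic ideal) is an SNLA.
   Context: A symplectic Lie algebra $(\mathfrak{g},\omega)$ is a finite-dimensional real Lie algebra with a skew-symmetric non-degenerate bilinear form $\omega$ satisfying $\omega([x,y],z)+\omega([y,z],x)+\omega([z,x],y)=0$. The left-symmetric product associated with $(\mathfrak{g},\omega)$ is the bilinear product defined by $\omega(x.y,z)=-\omega(y,[x,z])$; it is known to be left-symmetric with $x.y-y.x=[x,y]$. $(\mathfrak{g},\omega)$ is an SNLA if this product is Novikov: $(x.y).z=(x.z).y$ for all $x,y,z$. An ideal $\mathfrak{h}$ of $\mathfrak{g}$ is isotropic if $\omega|_{\mathfrak{h}\times\mathfrak{h}}=0$, i.e. $\mathfrak{h}\subseteq\mathfrak{h}^\perp$ ($\perp$ is the $\omega$-orthogonal). Then $\mathfrak{h}^\perp$ is a subalgebra containing $\mathfrak{h}$, and $\omega$ descends to a symplectic form $\overline{\omega}$ on $\overline{\mathfrak{g}}=\mathfrak{h}^\perp/\mathfrak{h}$; $(\overline{\mathfrak{g}},\overline{\omega})$ is the symplectic reduction of $(\mathfrak{g},\omega)$ with respect to $\mathfrak{h}$. *)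

(* Defs.v *)
From HB Require Import structures.
From mathcomp Require Import all_boot all_order all_algebra.
From mathcomp Require Import sesquilinear reals.

Set Implicit Arguments.
Unset Strict Implicit.
Unset Printing Implicit Defensive.

Import GRing.Theory Num.Theory.

Local Open Scope ring_scope.
Local Open Scope quotient_scope.

Section QuotientSpace.
Variables (F : fieldType) (V : vectType F) (U : {vspace V}).

Definition quotv := Quotient.quot (pred_of_vspace U : zmodClosed V).
HB.instance Definition _ := ZmodQuotient.on quotv.

Definition quotv_pi (v : V) : quotv := \pi_quotv v.

Lemma quotv_piP v w : reflect (quotv_pi v = quotv_pi w) (v - w \in U).
Proof. by rewrite Quotient.idealrBE; apply: eqP. Qed.

Lemma quotv_piK (q : quotv) : quotv_pi (repr q) = q.
Proof. exact: reprK. Qed.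

Lemma memv_repr_pi v : repr (quotv_pi v) - v \in U.
Proof. by apply/quotv_piP; rewrite quotv_piK. Qed.

Lemma quotv_piD : {morph quotv_pi : v w / v + w}.
Proof. exact: raddfD. Qed.

Definition quotv_scale (a : F) (q : quotv) : quotv := quotv_pi (a *: repr q).

Lemma quotv_scale_pi a v : quotv_scale a (quotv_pi v) = quotv_pi (a *: v).
Proof. by apply/quotv_piP; rewrite -scalerBr memvZ ?memv_repr_pi. Qed.

Lemma quotv_scalerA a b q :
  quotv_scale a (quotv_scale b q) = quotv_scale (a * b) q.
Proof. by rewrite -[q]quotv_piK !quotv_scale_pi scalerA. Qed.

Lemma quotv_scale1r : left_id 1 quotv_scale.
Proof. by move=> q; rewrite -[q]quotv_piK quotv_scale_pi scale1r. Qed.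

Lemma quotv_scalerDr : right_distributive quotv_scale +%R.
Proof.
move=> a q r; rewrite -[q]quotv_piK -[r]quotv_piK -quotv_piD.
by rewrite !quotv_scale_pi scalerDr quotv_piD.
Qed.

Lemma quotv_scalerDl q : {morph quotv_scale^~ q : a b / a + b}.
Proof.
by move=> a b; rewrite -[q]quotv_piK !quotv_scale_pi scalerDl quotv_piD.
Qed.

HB.instance Definition _ := GRing.Zmodule_isLmodule.Build F quotv
  quotv_scalerA quotv_scale1r quotv_scalerDr quotv_scalerDl.

Lemma quotv_pi_is_linear : linear quotv_pi.
Proof. by move=> a v w; rewrite quotv_piD -quotv_scale_pi. Qed.

HB.instance Definition _ :=
  GRing.isLinear.Build F V quotv _ quotv_pi quotv_pi_is_linear.

(* The projection onto the complement of U along U induces an isomorphism     *)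
(* from the quotient onto that complement.                                    *)
Lemma quotv_vect_iso : Vector.axiom (\dim U^C) quotv.
Proof.
pose p := daddv_pi U^C U; pose W := (U^C)%VS.
have dUC : (U^C :&: U = 0)%VS by rewrite capvC capv_compl.
have sUC v : v \in (U^C + U)%VS by rewrite addvC addv_complf memvf.
have pU v : v - p v \in U.
  by rewrite -{1}(daddv_pi_add dUC (sUC v)) addrC addKr memv_pi.
have pU0 v : v \in U -> p v = 0.
  move=> vU; apply/eqP; rewrite -memv0 -dUC memv_cap memv_pi /=.
  by rewrite -[p v](subKr v) memvB.
have pE v : p (repr (quotv_pi v)) = p v.
  apply/eqP; rewrite -subr_eq0 -(linearB p); apply/eqP.
  exact/pU0/memv_repr_pi.
have [f f_lin f_bij] : Vector.axiom (\dim W) (subvs_of W).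
  by exact: subvs_vect_iso.
exists (fun q => f (vsproj W (p (repr q)))).
  move=> a q r; rewrite -{1}[q]quotv_piK -{1}[r]quotv_piK.
  by rewrite -linearP pE !linearP f_lin.
case: f_bij => f' fK f'K; exists (fun u => quotv_pi (vsval (f' u))) => [q|u].
  rewrite fK vsprojK ?memv_pi // -{2}[q]quotv_piK; apply/quotv_piP.
  by rewrite -opprB memvN pU.
by rewrite pE (daddv_pi_id dUC) ?subvsP // vsvalK f'K.
Qed.

HB.instance Definition _ := Lmodule_hasFinDim.Build F quotv quotv_vect_iso.

End QuotientSpace.

HB.mixin Record Vector_isLieAlgebra (F : fieldType) L of Vector F L := {
  lie : L -> L -> L;
  lie_bilinear_subproof : bilinear_for *:%R *:%R lie;
  liexx : forall x, lie x x = 0;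
  lie_jacobi : forall x y z,
    lie x (lie y z) + lie y (lie z x) + lie z (lie x y) = 0
}.

#[short(type="lieAlgType")]
HB.structure Definition LieAlgebra (F : fieldType) :=
  { L of Vector_isLieAlgebra F L & Vector F L }.

HB.instance Definition _ (F : fieldType) (g : lieAlgType F) :=
  bilinear_isBilinear.Build F g g g _ _ (@lie F g) lie_bilinear_subproof.

Section LieAlgebraTheory.
Variables (F : fieldType) (g : lieAlgType F).

Lemma lieDl (x y z : g) : lie (x + y) z = lie x z + lie y z.
Proof. exact: linearDl. Qed.

Lemma lieDr (x y z : g) : lie x (y + z) = lie x y + lie x z.
Proof. exact: linearDr. Qed.

Lemma lieBl (x y z : g) : lie (x - y) z = lie x z - lie y z.
Proof. exact: linearBl. Qed.

Lemma lieBr (x y z : g) : lie x (y - z) = lie x y - lie x z.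
Proof. exact: linearBr. Qed.

Lemma lieC (x y : g) : lie x y = - lie y x.
Proof.
apply/eqP; rewrite -addr_eq0; have := liexx (x + y).
by rewrite lieDl !lieDr !liexx add0r addr0 => ->.
Qed.

(* By lieC, closure under bracketing on the left is enough.                   *)
Definition is_lie_ideal (h : {vspace g}) :=
  forall x y : g, y \in h -> lie x y \in h.

End LieAlgebraTheory.

Record symplecticForm (R : realType) (g : lieAlgType R) := SymplecticForm {
  symp_form :> {skew_symmetric g};
  symp_nondegenerate : nondegenerate symp_form;
  symp_closed : forall x y z : g,
    symp_form (lie x y) z + symp_form (lie y z) x + symp_form (lie z x) y = 0
}.

Section SymplecticTheory.
Variables (R : realType) (g : lieAlgType R) (om : symplecticForm g).

Lemma sympC x y : om x y = - om y x.
Proof. by rewrite hermC expr1 mulN1r. Qed.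

Lemma sympBl x y z : om (x - y) z = om x z - om y z.
Proof. exact: linearBl. Qed.

Lemma sympBr x y z : om x (y - z) = om x y - om x z.
Proof. exact: linearBr. Qed.

Lemma sympNl x y : om (- x) y = - om x y.
Proof. exact: linearNl. Qed.

Lemma symp_eq0 x : (forall y, om x y = 0) -> x = 0.
Proof.
move=> x0; apply/eqP; rewrite -memv0 -(eqP (symp_nondegenerate om)).
by apply/mem_orthovP => y _.
Qed.

(* flat is x |-> om x, an isomorphism from g to its dual.                     *)
Definition flat_fun (x : g) : 'Hom(g, R^o) := linfun (om x : g -> R^o).

Lemma flat_funE x y : flat_fun x y = om x y.
Proof. exact: lfunE. Qed.

Lemma flat_fun_is_linear : linear flat_fun.
Proof.
move=> a u v; apply/lfunP => w.
by rewrite add_lfunE scale_lfunE !flat_funE linearPl.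
Qed.

HB.instance Definition _ :=
  GRing.isLinear.Build R g 'Hom(g, R^o) _ flat_fun flat_fun_is_linear.

Definition flat : 'Hom(g, 'Hom(g, R^o)) := linfun flat_fun.

Lemma flatE x y : flat x y = om x y.
Proof. by rewrite lfunE /= flat_funE. Qed.

Lemma flat_bij : lker flat == 0%VS /\ limg flat = fullv.
Proof.
have k0 : lker flat == 0%VS.
  apply/lker0P => x y exy; apply/eqP; rewrite -subr_eq0; apply/eqP.
  apply: symp_eq0 => z; rewrite sympBl -!flatE exy subrr //.
split=> //; apply/eqP; rewrite eqEdim subvf /= limg_dim_eq.
  by rewrite !dimvf /dim /= muln1.
by rewrite (eqP k0) capv0.
Qed.

Lemma flatVE (l : 'Hom(g, R^o)) z : om ((flat^-1)%VF l) z = l z.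
Proof. by rewrite -flatE limg_lfunVK // flat_bij.2 memvf. Qed.

Definition lsprod_rhs (x y : g) : g -> R^o := fun z => - om y (lie x z).

Lemma lsprod_rhs_is_linear x y : linear (lsprod_rhs x y).
Proof. by move=> a u v; rewrite /lsprod_rhs !linearPr opprD scalerN. Qed.

HB.instance Definition _ x y :=
  GRing.isLinear.Build R g R^o _ (lsprod_rhs x y) (lsprod_rhs_is_linear x y).

(* The left-symmetric product x.y, given by om (x.y) z = - om y [x, z].       *)
Definition lsprod (x y : g) : g := (flat^-1)%VF (linfun (lsprod_rhs x y)).

Lemma lsprodE x y z : om (lsprod x y) z = - om y (lie x z).
Proof. by rewrite flatVE lfunE. Qed.

Lemma lsprod_unique x y u :
  (forall z, om u z = - om y (lie x z)) -> u = lsprod x y.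
Proof.
move=> uE; apply/eqP; rewrite -subr_eq0; apply/eqP/symp_eq0 => z.
by rewrite sympBl uE lsprodE subrr.
Qed.

(* g being already a symplectic Lie algebra, only the Novikov identity is     *)
(* left to require.                                                           *)
Definition is_SNLA :=
  forall x y z, lsprod (lsprod x y) z = lsprod (lsprod x z) y.

Lemma orthovK (h : {vspace g}) u : u \in orthov om (orthov om h) -> u \in h.
Proof.
move=> /mem_orthovP uhh; set w := u - projv h u.
suff w0 : w = 0 by rewrite -[u](subrK (projv h u)) -/w w0 add0r memv_proj.
rewrite (coord_vbasis (memvf w)) big1 // => i _.
pose c : g -> R^o := coord (vbasis {:g}) i.
pose l := (linfun c \o (\1 - projv h))%VF.
have lE v : l v = c (v - projv h v).
  by rewrite comp_lfunE add_lfunE opp_lfunE id_lfunE lfunE.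
have -> : coord (vbasis {:g}) i w = l u by rewrite lE.
rewrite -flatVE sympC uhh ?oppr0 ?scale0r //; apply/mem_orthovP => v vh.
by rewrite flatVE lE projv_id // subrr /c linear0.
Qed.

End SymplecticTheory.

Record isotropicIdeal (R : realType) (g : lieAlgType R)
    (om : symplecticForm g) := IsotropicIdeal {
  isot_space :> {vspace g};
  isot_ideal : is_lie_ideal isot_space;
  isot_isotropic : forall x y,
    x \in isot_space -> y \in isot_space -> om x y = 0
}.

Section SymplecticReduction.
Variables (R : realType) (g : lieAlgType R) (om : symplecticForm g).
Variable h : isotropicIdeal om.

Let P : {vspace g} := orthov om h.

Lemma isot_sub_orthov : (h <= P)%VS.
Proof.
by apply/subvP => x xh; apply/mem_orthovP => y; apply: isot_isotropic.
Qed.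

Lemma memv_lie_orthov : {in P &, forall x y, lie x y \in P}.
Proof.
move=> x y /mem_orthovP xP /mem_orthovP yP; apply/mem_orthovP => z zh.
have := symp_closed om x y z.
rewrite [om (lie y z) x]sympC xP ?isot_ideal // oppr0 addr0.
rewrite [lie z x]lieC sympNl [om (lie x z) y]sympC yP ?isot_ideal //.
by rewrite !oppr0 addr0.
Qed.

(* The quotient of orthov om h by h; as a subspace of the type subvs_of P, h  *)
(* is its preimage under the inclusion in g.                                  *)
Definition reduction := quotv (linfun vsval @^-1: h : {vspace subvs_of P})%VS.
HB.instance Definition _ := Vector.on reduction.

Definition red_pi : subvs_of P -> reduction := @quotv_pi _ _ _.
HB.instance Definition _ := GRing.Linear.on red_pi.

Lemma red_piK a : red_pi (repr a) = a.
Proof. exact: quotv_piK. Qed.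

Lemma red_piP x y : reflect (red_pi x = red_pi y) (vsval x - vsval y \in h).
Proof.
have -> : vsval x - vsval y = linfun (@vsval _ _ P) (x - y) by rewrite lfunE.
by rewrite memv_preim; apply: quotv_piP.
Qed.

Lemma memv_repr_red_pi x : vsval (repr (red_pi x)) - vsval x \in h.
Proof. by apply/red_piP; rewrite red_piK. Qed.

(* The operations of the reduction act on representatives; red_lie_pi and     *)
(* red_form_pi below show that they do not depend on the choice of these.     *)
Definition red_lie (a b : reduction) : reduction :=
  red_pi (vsproj P (lie (vsval (repr a)) (vsval (repr b)))).

Lemma red_lie_pi x y :
  red_lie (red_pi x) (red_pi y) = red_pi (vsproj P (lie (vsval x) (vsval y))).
Proof.
apply/red_piP; rewrite !vsprojK ?memv_lie_orthov ?subvsP //.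
set x' := vsval (repr _); set y' := vsval (repr _).
have -> : lie x' y' - lie (vsval x) (vsval y) =
    lie x' (y' - vsval y) - lie (vsval y) (x' - vsval x).
  rewrite !lieBr [lie _ x']lieC [lie _ (vsval x)]lieC.
  by rewrite opprD !opprK addrA subrK.
by rewrite memvB // isot_ideal // memv_repr_red_pi.
Qed.

Lemma red_lie_bilinear : bilinear_for *:%R *:%R red_lie.
Proof.
split=> c k a b /=; rewrite -[a]red_piK -[b]red_piK -[c]red_piK.
  rewrite -(linearP red_pi) !red_lie_pi -linearP -linearP.
  congr (red_pi (vsproj P _)).
  by rewrite [vsval _]linearP linearPl.
rewrite -(linearP red_pi) !red_lie_pi -linearP -linearP.
congr (red_pi (vsproj P _)).
by rewrite [vsval (_ + _)]linearP linearPr.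
Qed.

Lemma red_liexx a : red_lie a a = 0.
Proof. by rewrite -[a]red_piK red_lie_pi liexx !linear0. Qed.

Lemma red_lie_jacobi a b c :
  red_lie a (red_lie b c) + red_lie b (red_lie c a) + red_lie c (red_lie a b)
  = 0.
Proof.
rewrite -[a]red_piK -[b]red_piK -[c]red_piK !red_lie_pi -!linearD.
by rewrite !vsprojK ?memv_lie_orthov ?subvsP // lie_jacobi !linear0.
Qed.

HB.instance Definition _ := Vector_isLieAlgebra.Build R reduction
  red_lie_bilinear red_liexx red_lie_jacobi.

Lemma lie_red_pi x y :
  lie (red_pi x) (red_pi y) = red_pi (vsproj P (lie (vsval x) (vsval y))).
Proof. exact: red_lie_pi. Qed.

Definition red_form (a b : reduction) : R :=
  om (vsval (repr a)) (vsval (repr b)).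

Lemma red_form_pi x y : red_form (red_pi x) (red_pi y) = om (vsval x) (vsval y).
Proof.
have om0 z (w : subvs_of P) : z \in h -> om z (vsval w) = 0.
  by have /mem_orthovP wP := subvsP w => zh; rewrite sympC wP ?oppr0.
rewrite /red_form; set x' := repr _; set y' := repr _.
have -> : om (vsval x') (vsval y') = om (vsval x) (vsval y').
  by apply/eqP; rewrite -subr_eq0 -sympBl om0 ?memv_repr_red_pi.
rewrite sympC [RHS]sympC; congr (- _).
by apply/eqP; rewrite -subr_eq0 -sympBl om0 ?memv_repr_red_pi.
Qed.

Lemma red_form_bilinear : bilinear_for *%R (idfun \; *%R) red_form.
Proof.
split=> c k a b /=; rewrite -[a]red_piK -[b]red_piK -[c]red_piK.
  by rewrite -(linearP red_pi) !red_form_pi [vsval _]linearP linearPl.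
by rewrite -(linearP red_pi) !red_form_pi [vsval (_ + _)]linearP linearPr.
Qed.

HB.instance Definition _ := bilinear_isBilinear.Build R reduction reduction R
  *%R (idfun \; *%R) red_form red_form_bilinear.

Lemma red_form_hermitian a b :
  red_form a b = (-1) ^+ true * idfun (red_form b a).
Proof. by rewrite /red_form sympC expr1 mulN1r. Qed.

HB.instance Definition _ := isHermitianSesquilinear.Build R reduction
  true idfun red_form red_form_hermitian.

Lemma red_form_nondegenerate :
  nondegenerate (red_form : {skew_symmetric reduction}).
Proof.
rewrite /nondegenerate -subv0; apply/subvP => a /mem_orthovP a0.
rewrite memv0 -[a]red_piK -(linear0 red_pi); apply/eqP/red_piP.
rewrite -linearB subr0; apply: (@orthovK _ _ om); apply/mem_orthovP => y yP.
have := a0 (red_pi (vsproj P y)) (memvf _).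
by rewrite -{1}[a]red_piK [LHS]red_form_pi vsprojK.
Qed.

Lemma red_form_closed (a b c : reduction) :
  red_form (lie a b) c + red_form (lie b c) a + red_form (lie c a) b = 0.
Proof.
rewrite -[a]red_piK -[b]red_piK -[c]red_piK !lie_red_pi !red_form_pi.
by rewrite !vsprojK ?memv_lie_orthov ?subvsP // symp_closed.
Qed.

Definition red_symp : symplecticForm reduction :=
  SymplecticForm red_form_nondegenerate red_form_closed.

Lemma red_symp_pi x y : red_symp (red_pi x) (red_pi y) = om (vsval x) (vsval y).
Proof. exact: red_form_pi. Qed.

End SymplecticReduction.

(* Main.v *)
Require Import Defs.
From HB Require Import structures.
From mathcomp Require Import all_boot all_order all_algebra.
From mathcomp Require Import sesquilinear reals.

Set Implicit Arguments.
Unset Strict Implicit.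
Unset Printing Implicit Defensive.

Local Open Scope ring_scope.

(* x.y is om-orthogonal to h for every x, because om (x.y) z = - om y [x, z]  *)
(* and [x, z] \in h for z \in h. So orthov om h is closed under the product,  *)
(* and non-degeneracy of the reduced form identifies the product of the       *)
(* reduction with the induced one, which inherits the Novikov identity.       *)

Lemma memv_lsprod_orthov (R : realType) (g : lieAlgType R)
    (om : symplecticForm g) (h : isotropicIdeal om) (x y : g) :
  y \in orthov om h -> lsprod om x y \in orthov om h.
Proof.
move=> /mem_orthovP yP; apply/mem_orthovP => z zh.
by rewrite lsprodE yP ?GRing.oppr0 //; apply: isot_ideal.
Qed.

(** The reduced form and bracket are computed on representatives, so against any class [c] the
    defining identity of the reduced product becomes [lsprodE] in [g]; [lsprod_unique] concludes. *)
Lemma lsprod_red_pi (R : realType) (g : lieAlgType R) (om : symplecticForm g)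
    (h : isotropicIdeal om) (x y : subvs_of (orthov om h)) :
  lsprod (red_symp h) (red_pi x) (red_pi y) =
  red_pi (vsproj (orthov om h) (lsprod om (vsval x) (vsval y))).
Proof.
apply/esym/lsprod_unique => c; rewrite -[c]red_piK lie_red_pi !red_symp_pi.
by rewrite !vsprojK ?memv_lie_orthov ?memv_lsprod_orthov ?subvsP // lsprodE.
Qed.

Theorem lemma1 (R : realType) (g : lieAlgType R) (om : symplecticForm g)
    (h : isotropicIdeal om) :
  is_SNLA om -> is_SNLA (red_symp h).
Proof.
move=> novikov a b c; rewrite -[a]red_piK -[b]red_piK -[c]red_piK.
(* The inner product already lies in [orthov om h], so projecting it there changes nothing and both
   sides become classes of double products in [g]. *)
rewrite !lsprod_red_pi !vsprojK ?memv_lsprod_orthov ?subvsP //.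
by rewrite novikov.
Qed.
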